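(* Let $W\in\mathcal W_I$ and let $W_1,W_2,\dots\in\mathcal W_I$ be any sequence with $\delta_\Box(W_n,W)\to0$ as $n\to\infty$. (i) If $\mu(W^{-1}(\{0,1\}))=1$, then $\delta_1(W_n,W)\to0$ as $n\to\infty$. (ii) If $\mu(W^{-1}(\{0,1\}))<1$ and each $W_n$ takes only values in $\{0,1\}$ almost everywhere, then the sequence $(W_n)_{n\in\mathbb N}$ has no subsequence that is Cauchy with respect to $\delta_1$.
   Context: Let $I=[0,1]$ with Lebesgue measure $\mu$. $\mathcal W$ denotes the set of symmetric bounded functions $W:I^2\to\mathbb R$ measurable from the Lebesgue $\sigma$-algebra on $I^2$ to the Borel $\sigma$-algebra on $\mathbb R$; $\mathcal W_I$ is the set of $W\in\mathcal W$ with values in $[0,1]$. $\Phi_0$ is the set of bijections $\phi:I\to I$ such that $\phi$ and $\phi^{-1}$ are Lebesgue-to-Lebesgue measurable and measure preserving; $W^\phi(x,y)=W(\phi(x),\phi(y))$. $\|W\|_1=\int_{I^2}|W|\,d\mu$; the cut-norm is $\|W\|_\Box=\sup_{S,T}|\int_{S\times T}W\,d\mu|$ over Lebesgue measurable $S,T\subseteq I$. Define $\delta_\Box(U,W)=\inf_{\phi\in\Phi_0}\|U-W^\phi\|_\Box$ and $\delta_1(U,W)=\inf_{\phi\in\Phi_0}\|U-W^\phi\|_1$. *)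

(* Defs.v *)
From HB Require Import structures.
From mathcomp Require Import all_boot all_order all_algebra.
From mathcomp Require Import all_classical all_reals all_analysis.

Set Implicit Arguments.
Unset Strict Implicit.
Unset Printing Implicit Defensive.

Import Order.TTheory GRing.Theory Num.Theory.
Import numFieldNormedType.Exports.

Local Open Scope classical_set_scope.
Local Open Scope ring_scope.

(* Functions on [0, 1] and on [0, 1]^2 are represented by functions on R and on
   R * R; every notion below only depends on their values on [0, 1] and on
   [0, 1]^2. *)

Definition I01 {R : realType} : set R := `[0, 1]%classic.
Definition I01sq {R : realType} : set (R * R) := I01 `*` I01.

(* R with its Lebesgue sigma-algebra, on which completed_lebesgue_measure is
   defined *)
Definition lebT (R : realType) : measurableType _ :=
  caratheodory_type ((wlength (R := R) idfun)^*)%mu.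

Definition borel_lebesgue2 (R : realType) :
    {measure set (measurableTypeR R * measurableTypeR R) -> \bar R} :=
  (@lebesgue_measure R \x @lebesgue_measure R)%E.

(* R * R with its Lebesgue sigma-algebra: the Caratheodory-measurable sets of
   the product of the two Borel measures, i.e., its completion *)
Definition lebT2 (R : realType) : measurableType _ :=
  caratheodory_type ((@borel_lebesgue2 R)^*)%mu.

Definition lebesgue_measure2 {R : realType} :
    {measure set (lebT2 R) -> \bar R} :=
  @completed_measure_extension _ _ _ (@borel_lebesgue2 R).

Definition measurable_I01 (R : realType) : set (set R) :=
  [set S | measurable (S : set (lebT R)) /\ S `<=` I01].

(* The codomain R carries its Borel sigma-algebra. *)
Definition kernelW (R : realType) (W : R * R -> R) : Prop :=
  [/\ measurable_fun (I01sq : set (lebT2 R)) (W : lebT2 R -> R),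
      (exists M : R, forall z, I01sq z -> `|W z| <= M) &
      (forall x y, I01 x -> I01 y -> W (x, y) = W (y, x))].

Definition graphon (R : realType) (W : R * R -> R) : Prop :=
  kernelW W /\ (forall z, I01sq z -> 0 <= W z <= 1).

Definition measure_preserving (R : realType) (f : R -> R) : Prop :=
  measurable_fun (I01 : set (lebT R)) (f : lebT R -> lebT R) /\
  (forall A, measurable_I01 A ->
     completed_lebesgue_measure (I01 `&` f @^-1` A) =
     completed_lebesgue_measure A).

(* On [0, 1], 'pinv_(fun=> 0) I01 phi is the inverse of the bijection
   phi : [0, 1] -> [0, 1]; elsewhere it is 0. *)
Definition Phi0 (R : realType) : set (R -> R) :=
  [set phi | [/\ set_bij I01 I01 phi, measure_preserving phi &
                 measure_preserving ('pinv_(fun=> 0) I01 phi)]].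

Definition pullback (R : realType) (W : R * R -> R) (phi : R -> R)
  : R * R -> R := fun z => W (phi z.1, phi z.2).

Local Open Scope ereal_scope.

Definition norm1 (R : realType) (W : R * R -> R) : \bar R :=
  \int[lebesgue_measure2]_(z in I01sq) `|W z|%:E.

Definition cut_norm (R : realType) (W : R * R -> R) : \bar R :=
  ereal_sup [set `| \int[lebesgue_measure2]_(z in S `*` T) (W z)%:E |
            | S in @measurable_I01 R & T in @measurable_I01 R].

Definition delta_cut (R : realType) (U W : R * R -> R) : \bar R :=
  ereal_inf [set cut_norm (U \- pullback W phi)%R | phi in @Phi0 R].

Definition delta1 (R : realType) (U W : R * R -> R) : \bar R :=
  ereal_inf [set norm1 (U \- pullback W phi)%R | phi in @Phi0 R].

Definition cauchy_for (R : realType) (T : Type) (d : T -> T -> \bar R)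
    (u : nat -> T) : Prop :=
  forall e : R, (0 < e)%R -> exists N : nat,
    forall m n, (N <= m)%N -> (N <= n)%N -> d (u m) (u n) < e%:E.

(* Main.v *)
(* A bijection phi in Phi0, extended by the identity off [0, 1], acts on both
   coordinates as a measure-preserving map of the Lebesgue sigma-algebra of the
   plane.  For a fixed measurable E, the integral over (phi x phi)^-1(E) of a
   kernel D with |D| <= 1 is small, uniformly in phi, once the cut norm of D is
   small: this holds for rectangles by definition, and the sets E enjoying it
   are stable under complements and disjoint countable unions, hence contain the
   Borel sets, and then all Lebesgue sets.
   If U is 0/1-valued almost everywhere and u = U^phi, then for a graphon V the
   norm |V - u|_1 is the integral of 1 - V over {u = 1} plus that of V over
   {u = 0}, two preimages of fixed sets.  So |V - u|_1 and |W - u|_1 are close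
   when V - W is small in cut norm, uniformly in phi.
   Part (i) takes U = W and compares W_n with W^phi.  For part (ii), take
   U = W_m with m large and n far beyond m: W_n is L1-close to some W_m^phi and
   cut-close to some W^psi, so W^psi is L1-close to the 0/1-valued W_m^phi.  As
   [a, 1 - a] has distance a to {0, 1}, {a <= W <= 1 - a} is null. *)

Require Import Defs.
From HB Require Import structures.
From mathcomp Require Import all_boot all_order all_algebra.
From mathcomp Require Import all_classical all_reals all_analysis.
From mathcomp Require Import measurable_realfun ring lra.

Set Implicit Arguments.
Unset Strict Implicit.
Unset Printing Implicit Defensive.

Import Order.TTheory GRing.Theory Num.Theory.
Import numFieldNormedType.Exports.

Local Open Scope classical_set_scope.
Local Open Scope ring_scope.
Local Open Scope ereal_scope.

(** * Completion of a measure: approximation of completed sets by sets of the original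
    sigma-algebra *)

(** Covers of [E] with excess at most 1/(n+1) are intersected; if the outer measure is infinite, the
    whole space serves. *)
Lemma outer_measure_hull d (T : measurableType d) (R : realType)
    (mu : {measure set T -> \bar R}) (E : set T) :
  exists B, [/\ measurable B, E `<=` B & mu B = (mu^*)%mu E].
Proof.
have [Eoo|Eoo] := eqVneq ((mu^*)%mu E) +oo.
  exists setT; split=> //; apply/eqP; rewrite Eoo -leye_eq -Eoo.
  by rewrite -(measurable_mu_extE mu)//; exact: le_outer_measure.
have Efin : (mu^*)%mu E \is a fin_num.
  by rewrite ge0_fin_numE ?outer_measure_ge0// ltey.
have cover n : exists B, [/\ measurable B, E `<=` B &
    mu B <= (mu^*)%mu E + n.+1%:R^-1%:E].
  have n0 : (0 < n.+1%:R^-1 :> R)%R by rewrite invr_gt0.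
  have [_ [F [mF EF] <-] lt] := lb_ereal_inf_adherent n0 Efin.
  exists (\bigcup_k F k); split=> //; first exact: bigcupT_measurable.
  apply: le_trans (ltW lt).
  by apply: measure_sigma_subadditive => //; exact: bigcupT_measurable.
have {cover}[B PB] := choice cover.
have mB : measurable (\bigcap_n B n).
  by apply: bigcapT_measurable => n; have [] := PB n.
have EB : E `<=` \bigcap_n B n.
  by move=> x Ex n _; have [_ + _] := PB n; apply.
exists (\bigcap_n B n); split => //.
apply/eqP; rewrite eq_le; apply/andP; split; last first.
  by rewrite -(measurable_mu_extE mu mB); exact: le_outer_measure.
apply/lee_addgt0Pr => e e0.
near \oo => n.
have [mBn _ muBn] := PB n.
apply: (@le_trans _ _ (mu (B n))).
  by apply: le_measure; rewrite ?inE//; exact: bigcap_inf.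
apply: le_trans muBn _; rewrite leeD2l// lee_fin ltW//.
by near: n; exact: near_infty_natSinv_lt (PosNum e0).
Unshelve. all: by end_near. Qed.

(** With [B] a hull of [E] and [N] a hull of [B \ E], the set [B \ N] lies inside [E]. Finiteness
    allows the subtraction that makes [B \ E], hence [N], null. *)
Lemma caratheodory_sandwich d (T : measurableType d) (R : realType)
    (mu : {measure set T -> \bar R}) (E : set (caratheodory_type (mu^*)%mu)) :
  measurable E -> (mu^*)%mu E < +oo ->
  exists A N : set T, [/\ measurable A, measurable N, mu N = 0, A `<=` E &
    E `\` A `<=` N].
Proof.
move=> mE Eoo.
have [B [mB EB muB]] := outer_measure_hull mu E.
have [N [mN BEN muN]] := outer_measure_hull mu (B `\` E).
have Efin : (mu^*)%mu E \is a fin_num.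
  by rewrite ge0_fin_numE ?outer_measure_ge0.
have cB : (mu^*)%mu.-cara.-measurable B by exact: caratheodory_measurable_mu_ext.
have BE0 : (mu^*)%mu (B `\` E) = 0.
  pose cmu := @completed_measure_extension _ _ _ mu.
  have cmuE : cmu B = (mu^*)%mu E by rewrite -muB; exact: measurable_mu_extE.
  have cmuD : cmu (B `\` E) = cmu B - cmu (B `&` E).
    by apply: measureD => //; rewrite -[X in X < _]/(cmu B) cmuE.
  by rewrite -[LHS]/(cmu (B `\` E)) cmuD cmuE setIidr// subee.
exists (B `\` N), N; split => //.
- exact: measurableD.
- by rewrite muN BE0.
- move=> x [Bx Nx]; apply: contrapT => Ex; exact/Nx/BEN.
- by move=> x [Ex /not_andP[/(_ (EB _ Ex))|/contrapT]].
Qed.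

Lemma sandwich_measure d (T : measurableType d) (R : realType)
    (mu : {measure set T -> \bar R}) (A E N : set T) : measure_is_complete mu ->
  measurable A -> measurable N -> mu N = 0 -> A `<=` E -> E `\` A `<=` N ->
  measurable E /\ mu E = mu A.
Proof.
move=> cmu mA mN N0 AE EAN.
have mEA : measurable (E `\` A) by apply: cmu; exists N.
have EE : E = A `|` (E `\` A) by rewrite setDUK.
split; first by rewrite EE; exact: measurableU.
rewrite EE measureU0//; apply/eqP; rewrite -measure_le0 -N0 le_measure ?inE//.
Qed.

Lemma cvge0 (R : realType) (f : nat -> \bar R) : (forall n, 0 <= f n) ->
  (forall e : R, (0 < e)%R -> \forall n \near \oo, f n <= e%:E) ->
  f n @[n --> \oo] --> 0.
Proof.
move=> f0 fe; have finf : \forall n \near \oo, f n \is a fin_num.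
  apply: filterS (fe 1%R ltr01) => n fn; rewrite ge0_fin_numE//.
  by rewrite (le_lt_trans fn)// ltry.
apply/fine_cvgP; split => //; apply/cvgrPdist_le => e e0.
near=> n; rewrite sub0r normrN ger0_norm ?fine_ge0//.
rewrite -lee_fin fineK; last by near: n.
by near: n; exact: fe.
Unshelve. all: by end_near. Qed.

(** * Lebesgue measure on the line, the plane and the unit square *)

Section unit_square.
Context {R : realType}.
Local Notation mu2 := (@lebesgue_measure2 R).
Local Notation lam := (@completed_lebesgue_measure R).

Lemma lebesgue_measure2_is_complete : measure_is_complete mu2.
Proof. exact: measure_is_complete_caratheodory. Qed.

Lemma borel_lebT2 (E : set (measurableTypeR R * measurableTypeR R)) :
  measurable E -> measurable (E : set (lebT2 R)).
Proof. exact: caratheodory_measurable_mu_ext. Qed.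

Lemma lebesgue_measure2E (E : set (measurableTypeR R * measurableTypeR R)) :
  measurable E -> mu2 E = borel_lebesgue2 R E.
Proof. exact: measurable_mu_extE. Qed.

Lemma borel_lebesgue2X (A B : set (measurableTypeR R)) :
  measurable A -> measurable B ->
  borel_lebesgue2 R (A `*` B) = lebesgue_measure A * lebesgue_measure B.
Proof. by move=> mA mB; exact: product_measure1E. Qed.

Lemma borel_lebT (E : set (measurableTypeR R)) :
  measurable E -> measurable (E : set (lebT R)).
Proof. by move=> mE; exact: sub_caratheodory. Qed.

(** [S] may have infinite measure, so [caratheodory_sandwich] does not apply; instead, a Lebesgue
    set is a Borel set joined with a part of a null Borel set. *)
Lemma lebT_sandwich (S : set (lebT R)) : measurable S ->
  exists A N : set (measurableTypeR R),
    [/\ measurable A, measurable N, lebesgue_measure N = 0, A `<=` S &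
        S `\` A `<=` N].
Proof.
rewrite /measurable/= -[X in X S]completed_caratheodory_measurable.
rewrite g_sigma_completed_algebra_genE => -[A mA [N [B [mB B0 NB]]]] <-.
by exists A, B; split => // x [[//|/NB]].
Qed.

(** Sandwiching both sides by Borel sets leaves an error inside two strips, each with one null
    side. *)
Lemma lebT2_measurableX (S T : set (lebT R)) : measurable S -> measurable T ->
  measurable (S `*` T : set (lebT2 R)) /\ mu2 (S `*` T) = lam S * lam T.
Proof.
move=> mS mT.
have [A [N [mA mN N0 AS SAN]]] := lebT_sandwich mS.
have [B [M [mB mM M0 BT TBM]]] := lebT_sandwich mT.
have [_ ->] := sandwich_measure (@completed_lebesgue_measure_is_complete R)
  (borel_lebT mA) (borel_lebT mN) N0 AS SAN.
have [_ ->] := sandwich_measure (@completed_lebesgue_measure_is_complete R)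
  (borel_lebT mB) (borel_lebT mM) M0 BT TBM.
have mK : measurable (N `*` setT `|` setT `*` M :
    set (measurableTypeR R * measurableTypeR R)).
  by apply: measurableU; exact: measurableX.
have mAB : measurable (A `*` B : set (measurableTypeR R * measurableTypeR R)).
  exact: measurableX.
have [|||mST ->] := sandwich_measure lebesgue_measure2_is_complete
    (borel_lebT2 mAB) (borel_lebT2 mK) (E := (S `*` T : set (lebT2 R))).
- rewrite lebesgue_measure2E// measureU0//.
  (* The strip is unbounded, so this relies on the convention that 0 times infinity is 0. *)
  + by rewrite borel_lebesgue2X// N0 mul0e.
  + exact: measurableX.
  + exact: measurableX.
  + by rewrite borel_lebesgue2X// M0 mule0.
- by move=> [x y] [/= /AS ? /BT].
- move=> [x y] [[/= Sx Ty]] /not_andP[nA|nB].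
  + by left; split => //; apply: SAN.
  + by right; split => //; apply: TBM.
split => //.
by rewrite lebesgue_measure2E// borel_lebesgue2X.
Qed.

Lemma measurable_I01T : measurable (I01 : set (lebT R)).
Proof. by apply: borel_lebT; exact: measurable_itv. Qed.

Lemma lebesgue_measure_I01 : lam I01 = 1.
Proof.
transitivity (lebesgue_measure (I01 : set R)) => //.
by rewrite /I01 lebesgue_measure_itv/= lte_fin ltr01 oppr0 adde0.
Qed.

Lemma measurable_I01sq : measurable (I01sq : set (lebT2 R)).
Proof. by have [] := lebT2_measurableX measurable_I01T measurable_I01T. Qed.

Lemma lebesgue_measure2_I01sq : mu2 I01sq = 1.
Proof.
have [_] := lebT2_measurableX measurable_I01T measurable_I01T.
by rewrite lebesgue_measure_I01 mule1.
Qed.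

Lemma lebesgue_measure2_sub_I01sq (A : set (lebT2 R)) :
  measurable A -> A `<=` I01sq -> mu2 A <= 1.
Proof.
move=> mA AI; rewrite -lebesgue_measure2_I01sq.
by apply: le_measure; rewrite ?inE//; exact: measurable_I01sq.
Qed.

Lemma lebesgue_measure2_lty (A : set (lebT2 R)) :
  measurable A -> A `<=` I01sq -> mu2 A < +oo.
Proof.
move=> mA AI; apply: le_lt_trans (lebesgue_measure2_sub_I01sq mA AI) _.
exact: ltry.
Qed.

(** * The action of [Phi0] on the line and on the plane *)

(* The identity off [0, 1] makes this measure preserving on the whole line, so
   that uniqueness of product measures applies to its square directly. *)
Definition extend (phi : R -> R) : R -> R := patch id I01 phi.

Definition extend2 (phi : R -> R) (z : R * R) : R * R :=
  (extend phi z.1, extend phi z.2).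

Lemma extend_I01 phi x : I01 x -> extend phi x = phi x.
Proof. by move=> Ix; rewrite /extend /patch mem_set. Qed.

Lemma extend_preimage phi (A : set R) :
  extend phi @^-1` A = (I01 `&` phi @^-1` A) `|` (A `\` I01).
Proof.
apply/seteqP; split => x /=; rewrite /extend /patch.
  by case: ifPn => [/set_mem|/negP nI] ? ; [left|right; split => // /mem_set].
by case=> -[h1 h2]; [rewrite mem_set|rewrite memNset].
Qed.

Section fixed_map.
Variables (phi : R -> R) (phiP : Phi0 phi).

Lemma Phi0_homo x : I01 x -> I01 (phi x).
Proof. by have [[+ _ _] _ _] := phiP; apply. Qed.

Lemma extend_in x : I01 (extend phi x) <-> I01 x.
Proof.
rewrite /extend /patch; case: ifPn => [/set_mem Ix|//].
by split => // _; exact: Phi0_homo.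
Qed.

Lemma extend2_I01sq : extend2 phi @^-1` I01sq = I01sq.
Proof.
by apply/seteqP; split => -[x y] [/= Ix Iy]; split => /=; exact/extend_in.
Qed.

Lemma measurable_extend : measurable_fun setT (extend phi : lebT R -> lebT R).
Proof.
move=> _ A mA; rewrite setTI extend_preimage; apply: measurableU.
  by have [_ [mphi _] _] := phiP; apply: mphi => //; exact: measurable_I01T.
by apply: measurableD => //; exact: measurable_I01T.
Qed.

Lemma extend_measure (A : set (lebT R)) : measurable A ->
  lam (extend phi @^-1` A) = lam A.
Proof.
move=> mA; have mI := measurable_I01T.
have [_ [mphi phiE] _] := phiP.
have mIA : measurable (A `&` I01 : set (lebT R)) by exact: measurableI.
have mAI : measurable (A `\` I01 : set (lebT R)) by exact: measurableD.
rewrite extend_preimage measureU//=; last 2 first.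
  by apply: mphi.
  by apply/seteqP; split => // x [[]] ? _ [].
(* Measure preservation is given only for subsets of [0, 1]; since [phi] maps [0, 1] into itself,
   [A] can be cut down to such a subset. *)
rewrite (_ : I01 `&` phi @^-1` A = I01 `&` phi @^-1` (A `&` I01)); last first.
  by apply/seteqP; split => x [Ix] => [Ax|[]//]; split => //; split => //;
    exact: Phi0_homo.
rewrite phiE; last by split => // x [].
rewrite -measureU//=.
- by rewrite setDE -setIUr setUCr setIT.
- by apply/seteqP; split => // x [[] _ ? []].
Qed.

(** Preimages of Borel rectangles are rectangles with Lebesgue sides. The target carries only the
    Borel sets, because Lebesgue sets also require that null sets pull back to null sets. *)
Lemma measurable_extend2_borel : measurable_fun setT
  (extend2 phi : lebT2 R -> (measurableTypeR R * measurableTypeR R)%type).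
Proof.
apply: measurable_fun_pair => _ A mA; rewrite setTI.
- have mE : measurable (extend phi @^-1` A : set (lebT R)).
    by rewrite -[X in measurable X]setTI; apply: measurable_extend => //; exact: borel_lebT.
  have [+ _] := lebT2_measurableX mE (@measurableT _ (lebT R)).
  by rewrite setXT.
- have mE : measurable (extend phi @^-1` A : set (lebT R)).
    by rewrite -[X in measurable X]setTI; apply: measurable_extend => //; exact: borel_lebT.
  have [+ _] := lebT2_measurableX (@measurableT _ (lebT R)) mE.
  by rewrite setTX.
Qed.

(** The push-forward of the plane measure agrees with the product measure on rectangles, hence on
    all Borel sets by uniqueness of product measures. *)
Lemma extend2_measure_borel (E : set (measurableTypeR R * measurableTypeR R)) :
  measurable E -> mu2 (extend2 phi @^-1` E) = mu2 E.
Proof.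
move=> mE; rewrite [RHS]lebesgue_measure2E//.
pose f : lebT2 R -> (measurableTypeR R * measurableTypeR R)%type := extend2 phi.
have := @product_measure_unique _ _ _ _ R lebesgue_measure lebesgue_measure
  (pushforward mu2 f).
move=> /(_ measurable_extend2_borel) h; apply/esym; apply: (h _ E mE) => {E mE}.
move=> A B mA mB; have mA' := borel_lebT mA; have mB' := borel_lebT mB.
rewrite /pushforward.
have mEA : measurable (extend phi @^-1` A : set (lebT R)).
  by rewrite -[X in measurable X]setTI; exact: measurable_extend.
have mEB : measurable (extend phi @^-1` B : set (lebT R)).
  by rewrite -[X in measurable X]setTI; exact: measurable_extend.
have [_] := lebT2_measurableX mEA mEB.
by rewrite !extend_measure.
Qed.

(** The Borel sandwich of [E] pulls back to a sandwich of the preimage, its null set staying null;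
    completeness does the rest. *)
Lemma measurable_extend2 (E : set (lebT2 R)) : measurable E -> E `<=` I01sq ->
  measurable (extend2 phi @^-1` E : set (lebT2 R)) /\
  mu2 (extend2 phi @^-1` E) = mu2 E.
Proof.
move=> mE EI.
have [A [N [mA mN N0 AE EAN]]] := caratheodory_sandwich mE (lebesgue_measure2_lty mE EI).
have mpre (B : set (measurableTypeR R * measurableTypeR R)) : measurable B ->
    measurable (extend2 phi @^-1` B : set (lebT2 R)).
  by move=> mB; rewrite -[X in measurable X]setTI; exact: measurable_extend2_borel.
have N0' : mu2 N = 0 by rewrite lebesgue_measure2E.
have [_ ->] := sandwich_measure lebesgue_measure2_is_complete
  (borel_lebT2 mA) (borel_lebT2 mN) N0' AE EAN.
rewrite -(extend2_measure_borel mA).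
apply: (sandwich_measure lebesgue_measure2_is_complete (mpre _ mA) (mpre _ mN)).
- by rewrite extend2_measure_borel.
- exact: preimage_subset.
- by move=> z [Ez nA]; apply: EAN.
Qed.

End fixed_map.

(** * Integrals of functions bounded by 1 on the square *)

Definition unit_bounded (D : R * R -> R) :=
  measurable_fun (I01sq : set (lebT2 R)) (D : lebT2 R -> R) /\
  forall z, I01sq z -> (`|D z| <= 1)%R.

Lemma unit_bounded_integrable (D : R * R -> R) (A : set (lebT2 R)) :
  unit_bounded D -> measurable A -> A `<=` I01sq ->
  mu2.-integrable A (EFin \o (D : lebT2 R -> R)).
Proof.
move=> [mD D1] mA AI; apply: measurable_bounded_integrable => //.
- exact: lebesgue_measure2_lty.
- by apply: measurable_funS mD => //; exact: measurable_I01sq.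
- exists 1%R; split => // x x1 z /= Az.
  by apply: le_trans (ltW x1); apply: D1; exact: AI.
Qed.

Lemma unit_bounded_integral_le (D : R * R -> R) (A : set (lebT2 R)) :
  unit_bounded D -> measurable A -> A `<=` I01sq ->
  `| \int[mu2]_(z in A) (D z)%:E | <= mu2 A.
Proof.
move=> bD mA AI; have /integrableP[mDA _] := unit_bounded_integrable bD mA AI.
apply: le_trans (le_abse_integral _ mA mDA) _.
rewrite -[leRHS]mul1e; apply: integral_le_bound => //.
by apply: aeW => z /AI Iz; rewrite lee_fin; apply bD.2.
Qed.

Lemma unit_bounded_integralU (D : R * R -> R) (A B : set (lebT2 R)) :
  unit_bounded D -> measurable A -> measurable B ->
  A `<=` I01sq -> B `<=` I01sq -> A `&` B = set0 ->
  \int[mu2]_(z in A `|` B) (D z)%:E =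
  \int[mu2]_(z in A) (D z)%:E + \int[mu2]_(z in B) (D z)%:E.
Proof.
move=> bD mA mB AI BI AB; apply: integral_setU; [exact: mA|exact: mB| |exact/disj_set2P].
apply/measurable_EFinP; apply: measurable_funS bD.1; last by rewrite subUset.
exact: measurable_I01sq.
Qed.

Lemma cut_norm_rectangle (D : R * R -> R) (S T : set R) (c : \bar R) :
  cut_norm D < c -> measurable_I01 S -> measurable_I01 T ->
  `| \int[mu2]_(z in S `*` T) (D z)%:E | <= c.
Proof.
move=> Dc mS mT; apply: le_trans (ltW Dc).
by apply: ereal_sup_ubound; exists S => //; exists T.
Qed.

(** * Uniform control by the cut norm of integrals over preimages *)

(** The intersection with the square lets [E] range over all Borel sets of the plane, as an
    induction on the sigma-algebra demands. *)
Definition pre_on (phi : R -> R) (E : set (R * R)) : set (lebT2 R) :=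
  I01sq `&` extend2 phi @^-1` E.

(** The order of quantifiers matters: [d] depends on [E] and [e] only, so the bound is uniform in
    [phi] and [D]. *)
Definition cut_controlled (E : set (R * R)) := forall e : R, (0 < e)%R ->
  exists2 d : R, (0 < d)%R & forall phi D, Phi0 phi -> unit_bounded D ->
    cut_norm D < d%:E ->
    `| \int[mu2]_(z in pre_on phi E) (D z)%:E | <= e%:E.

Lemma pre_on_measurable phi (E : set (R * R)) : Phi0 phi ->
  measurable (E : set (measurableTypeR R * measurableTypeR R)) ->
  measurable (pre_on phi E).
Proof.
move=> phiP mE; apply: measurableI; first exact: measurable_I01sq.
by rewrite -[X in measurable X]setTI; exact: measurable_extend2_borel.
Qed.

Lemma pre_on_sub phi E : pre_on phi E `<=` I01sq.
Proof. exact: subIsetl. Qed.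

Lemma pre_onU phi E F : pre_on phi (E `|` F) = pre_on phi E `|` pre_on phi F.
Proof. by rewrite /pre_on preimage_setU setIUr. Qed.

Lemma pre_onI phi E F : pre_on phi (E `&` F) = pre_on phi E `&` pre_on phi F.
Proof. by rewrite /pre_on preimage_setI [RHS]setIACA setIid. Qed.

Lemma pre_on0 phi : pre_on phi set0 = set0.
Proof. by rewrite /pre_on preimage_set0 setI0. Qed.

Lemma fin_num_integral_pre_on phi (D : R * R -> R) E : unit_bounded D ->
  measurable (pre_on phi E) ->
  \int[mu2]_(z in pre_on phi E) (D z)%:E \is a fin_num.
Proof.
move=> bD mE; apply: integrable_fin_num => //.
apply: unit_bounded_integrable => //; exact: pre_on_sub.
Qed.

Lemma integral_pre_onU phi (D : R * R -> R) E F : unit_bounded D ->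
  measurable (pre_on phi E) -> measurable (pre_on phi F) -> E `&` F = set0 ->
  \int[mu2]_(z in pre_on phi (E `|` F)) (D z)%:E =
  \int[mu2]_(z in pre_on phi E) (D z)%:E + \int[mu2]_(z in pre_on phi F) (D z)%:E.
Proof.
move=> bD mE mF EF; rewrite pre_onU unit_bounded_integralU//.
- exact: pre_on_sub.
- exact: pre_on_sub.
- by rewrite -pre_onI EF pre_on0.
Qed.

(** A product map pulls a rectangle back to a rectangle, which the cut norm already tests; so [d]
    can be [e] itself. *)
Lemma cut_controlledX (A B : set (measurableTypeR R)) :
  measurable A -> measurable B -> cut_controlled (A `*` B).
Proof.
move=> mA mB e e0; exists e => // phi D phiP bD De.
have mI := measurable_I01T.
have mpre (C : set (measurableTypeR R)) : measurable C ->
    measurable_I01 (I01 `&` extend phi @^-1` C).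
  move=> mC; split; last exact: subIsetl.
  apply: measurableI => //; rewrite -[X in measurable X]setTI.
  by apply: measurable_extend => //; exact: borel_lebT.
rewrite [X in integral _ X](_ : _ = (I01 `&` extend phi @^-1` A) `*`
   (I01 `&` extend phi @^-1` B)); last first.
  by apply/seteqP; split => -[x y] [[/= ? ?] [/= ? ?]].
exact: (cut_norm_rectangle De (mpre _ mA) (mpre _ mB)).
Qed.

Lemma cut_controlledC (E : set (measurableTypeR R * measurableTypeR R)) :
  measurable E -> cut_controlled E -> cut_controlled (~` E).
Proof.
move=> mE PE e e0; have e20 : (0 < e / 2)%R by rewrite divr_gt0.
(* The whole plane is a rectangle, so the integral over the square is controlled; that over the
   complement is a difference of two controlled integrals. *)
have [d1 d10 P1] := @cut_controlledX setT setT measurableT measurableT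
  (e / 2)%R e20.
have [d2 d20 P2] := PE (e / 2)%R e20.
exists (Num.min d1 d2); first by rewrite lt_min d10.
move=> phi D phiP bD; rewrite EFin_min lt_min => /andP[D1 D2].
have {}P1 := P1 phi D phiP bD D1.
have {}P2 := P2 phi D phiP bD D2.
have mpE := pre_on_measurable phiP mE.
have mpEC := pre_on_measurable phiP (measurableC mE).
have h : \int[mu2]_(z in pre_on phi (setT `*` setT)) (D z)%:E =
    \int[mu2]_(z in pre_on phi E) (D z)%:E +
    \int[mu2]_(z in pre_on phi (~` E)) (D z)%:E.
  by rewrite setXTT -(setUCr E) integral_pre_onU// setICr.
move: h P1 P2.
set a := \int[mu2]_(z in _) _; set b := \int[mu2]_(z in _) _.
set c := \int[mu2]_(z in _) _.
have fb : b \is a fin_num.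
  exact: fin_num_integral_pre_on.
have fc : c \is a fin_num.
  exact: fin_num_integral_pre_on.
rewrite -(fineK fb) -(fineK fc) => ->.
rewrite -EFinD !abse_EFin !lee_fin !ler_norml => /andP[? ?] /andP[? ?].
apply/andP; split; lra.
Qed.

Lemma cut_controlledU (E F : set (measurableTypeR R * measurableTypeR R)) :
  measurable E -> measurable F -> E `&` F = set0 ->
  cut_controlled E -> cut_controlled F -> cut_controlled (E `|` F).
Proof.
move=> mE mF EF PE PF e e0; have e20 : (0 < e / 2)%R by rewrite divr_gt0.
have [d1 d10 P1] := PE (e / 2)%R e20.
have [d2 d20 P2] := PF (e / 2)%R e20.
exists (Num.min d1 d2); first by rewrite lt_min d10.
move=> phi D phiP bD; rewrite EFin_min lt_min => /andP[D1 D2].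
rewrite integral_pre_onU//.
- rewrite (splitr e) EFinD. apply: le_trans (lee_abs_add _ _) _.
  apply: leeD; [exact: P1 D1|exact: P2 D2].
- exact: pre_on_measurable.
- exact: pre_on_measurable.
Qed.

(** A finite partial union is controlled by additivity. The tail has small measure inside the
    square, its preimage has the same measure for every [phi], and [D] is bounded by 1. *)
Lemma cut_controlled_bigcup (F : (set (measurableTypeR R * measurableTypeR R))^nat) :
  (forall n, measurable (F n)) -> trivIset setT F ->
  (forall n, cut_controlled (F n)) -> cut_controlled (\bigcup_k F k).
Proof.
move=> mF tF PF e e0; have e20 : (0 < e / 2)%R by rewrite divr_gt0.
pose E k := \big[setU/set0]_(i < k) F i.
have mE k : measurable (E k) by exact: bigsetU_measurable.
have mUF : measurable (\bigcup_k F k) by exact: bigcupT_measurable.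
have PE k : cut_controlled (E k).
  elim: k => [|k IHk].
    by have := cut_controlledX measurableT measurable0; rewrite /E big_ord0 setX0.
  rewrite /E big_ord_recr/=; apply: cut_controlledU => //; first exact: mE.
  rewrite -bigcup_mkord. apply/seteqP; split => // z [[i /= ik Fi] Fk].
  by move: ik; rewrite (tF i k Logic.I Logic.I) ?ltnn//; exists z.
(* Cutting the tail down to the square makes its measure finite, as continuity from above
   requires. *)
pose T k : set (lebT2 R) := I01sq `&` (\bigcup_k F k `\` E k).
have mT k : measurable (T k).
  apply: measurableI; first exact: measurable_I01sq.
  by apply: borel_lebT2; exact: measurableD.
have T0 : mu2 (T k) @[k --> \oo] --> 0.
  rewrite -(measure0 mu2) (_ : set0 = \bigcap_k T k); last first.
    apply/esym/seteqP; split => // z Tz.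
    have [_ [[k _ Fkz] _]] := Tz 0%N Logic.I.
    (* [E k.+1] is the first partial union that includes [F k]. *)
    have [_ [_ ]] := Tz k.+1 Logic.I; apply.
    by rewrite /E -bigcup_mkord; exists k => /=.
  apply: nonincreasing_cvg_mu => //.
  - by apply: lebesgue_measure2_lty => //; exact: subIsetl.
  - exact: bigcapT_measurable.
  - move=> m n mn; apply/subsetPset => z [Iz [Fz nEz]]; split => //; split => //.
    apply: contra_not nEz; rewrite /E -!bigcup_mkord => -[i /= im Fiz].
    by exists i => //=; exact: leq_trans mn.
have [k Tk] : exists k, mu2 (T k) <= (e / 2)%:E.
  have e20' : 0 < (e / 2)%:E by rewrite lte_fin.
  have [k _ /(_ k (leqnn k))] := T0 _ (open_ereal_lt' e20').
  by move=> /ltW; exists k.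
have [d d0 Pd] := PE k _ e20; exists d => // phi D phiP bD Dd.
have TE : pre_on phi (\bigcup_k F k `\` E k) = extend2 phi @^-1` (T k).
  by rewrite /pre_on /T preimage_setI extend2_I01sq.
have [mpT pT] := measurable_extend2 phiP (mT k) (@subIsetl _ _ _).
rewrite (_ : \bigcup_k F k = E k `|` (\bigcup_k F k `\` E k)); last first.
  rewrite setDUK//; rewrite /E -bigcup_mkord; exact: bigcup_subset.
rewrite integral_pre_onU//.
- rewrite (splitr e) EFinD; apply: le_trans (lee_abs_add _ _) _.
  apply: leeD; first exact: Pd Dd.
  apply: le_trans Tk; rewrite -pT TE; apply: unit_bounded_integral_le => //.
  by rewrite -TE; exact: pre_on_sub.
- exact: pre_on_measurable.
- by rewrite TE.
- exact: setDIK.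
Qed.

(** Dynkin's pi-lambda theorem, with the rectangles as the pi-system. *)
Lemma cut_controlled_borel (E : set (measurableTypeR R * measurableTypeR R)) :
  measurable E -> cut_controlled E.
Proof.
rewrite measurable_prod_measurableType => mE.
apply: (dynkin_induction _ _ _ _ _ _ mE).
- by rewrite measurable_prod_measurableType.
- move=> _ _ [A1 mA1 [B1 mB1 <-]] [A2 mA2 [B2 mB2 <-]].
  exists (A1 `&` A2); first exact: measurableI.
  exists (B1 `&` B2); first exact: measurableI.
  by rewrite setXI.
- by rewrite -setXTT; exact: cut_controlledX.
- by move=> _ [A mA [B mB <-]]; exact: cut_controlledX.
- by move=> S mS; exact: cut_controlledC.
- exact: cut_controlled_bigcup.
Qed.

(** A Borel set inside [E] carries the estimate; the remainder is null, and so is its preimage under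
    every [phi]. *)
Lemma cut_controlled_lebT2 (E : set (lebT2 R)) :
  measurable E -> E `<=` I01sq -> cut_controlled E.
Proof.
move=> mE EI e e0.
have [A [N [mA mN N0 AE EAN]]] := caratheodory_sandwich mE (lebesgue_measure2_lty mE EI).
have [d d0 Pd] := cut_controlled_borel mA e0.
exists d => // phi D phiP bD Dd.
have mpA := pre_on_measurable phiP mA.
have mEA : measurable (E `\` A : set (lebT2 R)).
  by apply: measurableD => //; exact: borel_lebT2.
have EA0 : mu2 (E `\` A) = 0.
  apply/eqP; rewrite -measure_le0 -[leRHS]N0 -lebesgue_measure2E//.
  by apply: le_measure; rewrite ?inE//; exact: borel_lebT2.
have [mpEA pEA0] := measurable_extend2 phiP mEA (subset_trans (@subDsetl _ _ _) EI).
have pEA : pre_on phi (E `\` A) = extend2 phi @^-1` (E `\` A).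
  by rewrite -{2}(setIidr (subset_trans (@subDsetl _ E A) EI)) preimage_setI extend2_I01sq.
rewrite -(setDUK AE).
rewrite integral_pre_onU//.
- apply: le_trans (lee_abs_add _ _) _.
  rewrite -[leRHS]adde0; apply: leeD; first exact: Pd Dd.
  rewrite pEA -EA0 -pEA0; apply: unit_bounded_integral_le => //.
  by rewrite -pEA; exact: pre_on_sub.
- by rewrite pEA.
- exact: setDIK.
Qed.

(** * Graphons, their pullbacks and the set where they are not 0/1-valued *)

Lemma graphon_preimage (W : R * R -> R) (Y : set R) :
  graphon W -> measurable Y -> measurable (I01sq `&` W @^-1` Y : set (lebT2 R)).
Proof. by move=> [[mW _ _] _] mY; apply: mW => //; exact: measurable_I01sq. Qed.

Lemma graphon_pullback (W : R * R -> R) (phi : R -> R) :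
  Phi0 phi -> graphon W -> graphon (pullback W phi).
Proof.
move=> phiP gW.
have phiI z : I01sq z -> I01sq (phi z.1, phi z.2).
  by move=> [? ?]; split; exact: Phi0_homo.
have [[_ [M WM] Wsym] W01] := gW; split; last by move=> z /phiI/W01.
split.
- move=> _ Y mY.
  have [+ _] := measurable_extend2 phiP (graphon_preimage gW mY) (@subIsetl _ _ _).
  congr measurable; rewrite preimage_setI extend2_I01sq//.
  apply/seteqP; split => -[x y] [[/= Ix Iy]];
    by rewrite /extend2 /pullback/= !extend_I01.
- by exists M => z /phiI/WM.
- by move=> x y Ix Iy; apply: Wsym; exact: Phi0_homo.
Qed.

Lemma unit_bounded_sub (V W : R * R -> R) :
  graphon V -> graphon W -> unit_bounded (V \- W)%R.
Proof.
move=> [[mV _ _] V01] [[mW _ _] W01]; split; first exact: measurable_funB.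
move=> z Iz /=; have /andP[? ?] := V01 z Iz; have /andP[? ?] := W01 z Iz.
by rewrite ler_norml; apply/andP; split; lra.
Qed.

Lemma unit_bounded_norm (D : R * R -> R) :
  unit_bounded D -> unit_bounded (fun z => `|D z|%R).
Proof.
move=> [mD D1]; split => [|z Iz]; first exact: measurableT_comp.
by rewrite normr_id; exact: D1.
Qed.

Definition not01 (W : R * R -> R) : set (lebT2 R) :=
  I01sq `\` W @^-1` [set 0%R; 1%R].

Lemma measurable_set01 : measurable ([set 0%R; 1%R] : set R).
Proof. by apply: measurableU; exact: measurable_set1. Qed.

Lemma measurable_not01 W : graphon W -> measurable (not01 W).
Proof.
(* [W] is measurable only on the square, so its preimage must first be intersected with the
   square. *)
move=> gW; rewrite /not01 setDE -[X in X `&` _]setIid -setIA -setDE.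
rewrite (_ : I01sq `\` _ = I01sq `\` (I01sq `&` W @^-1` [set 0%R; 1%R])).
  apply: measurableI; first exact: measurable_I01sq.
  apply: measurableD; first exact: measurable_I01sq.
  exact: graphon_preimage measurable_set01.
by rewrite setDIr setDv set0U.
Qed.

Lemma not01_measure W : graphon W ->
  mu2 (I01sq `&` W @^-1` [set 0%R; 1%R]) + mu2 (not01 W) = 1.
Proof.
move=> gW; rewrite -lebesgue_measure2_I01sq -measureU//.
- by rewrite /not01 setUIDK.
- exact: graphon_preimage measurable_set01.
- exact: measurable_not01.
- by rewrite /not01 setIDA; apply/seteqP; split => // z [[[_ ?] _] ].
Qed.

(** * L1 distance to relabelled 0/1-valued graphons *)

(** With [u = pullback U phi], the two norms differ by the integral of [V - W] over {u = 0} minus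
    that over {u = 1}, each at most [e / 2] in absolute value. That [d] depends only on [U] and [e]
    allows part (ii) to choose [V] and [phi] afterwards. *)
Lemma norm1_cut_close (U : R * R -> R) (e : R) : graphon U ->
  mu2 (not01 U) = 0 -> (0 < e)%R ->
  exists2 d : R, (0 < d)%R & forall phi V W, Phi0 phi -> graphon V -> graphon W ->
    cut_norm (V \- W)%R < d%:E ->
    norm1 (V \- pullback U phi)%R <= norm1 (W \- pullback U phi)%R + e%:E /\
    norm1 (W \- pullback U phi)%R <= norm1 (V \- pullback U phi)%R + e%:E.
Proof.
move=> gU U0 e0; have e20 : (0 < e / 2)%R by rewrite divr_gt0.
pose E c : set (lebT2 R) := I01sq `&` U @^-1` [set c].
have mE c : measurable (E c) by exact: graphon_preimage (measurable_set1 c).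
have EI c : E c `<=` I01sq by exact: subIsetl.
have [d1 d10 P1] := cut_controlled_lebT2 (mE 1%R) (@EI 1%R) e20.
have [d0 d00 P0] := cut_controlled_lebT2 (mE 0%R) (@EI 0%R) e20.
exists (Num.min d1 d0); first by rewrite lt_min d10.
move=> phi V W phiP gV gW.
rewrite EFin_min lt_min => /andP[cd1 cd0].
have bVW := unit_bounded_sub gV gW.
have {}P1 := P1 phi _ phiP bVW cd1.
have {}P0 := P0 phi _ phiP bVW cd0.
pose u := pullback U phi.
have gu : graphon u by exact: graphon_pullback.
have pre (A : set (lebT2 R)) : measurable A -> A `<=` I01sq ->
    measurable (pre_on phi A) /\ mu2 (pre_on phi A) = mu2 A.
  move=> mA AI; suff -> : pre_on phi A = extend2 phi @^-1` A.
    exact: measurable_extend2.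
  by rewrite -[in RHS](setIidr AI) preimage_setI extend2_I01sq.
have [mp1 _] := pre _ (mE 1%R) (@EI _).
have [mp0 _] := pre _ (mE 0%R) (@EI _).
have [mpZ Z0] := pre _ (measurable_not01 gU) (@subDsetl _ _ _).
have uE c z : pre_on phi (E c) z -> u z = c.
  by move: z => [x y] [[/= Ix Iy] [_ /=]]; rewrite /extend2/= !extend_I01.
(* The third piece, where [u] is neither 0 nor 1, is the preimage of a null set and contributes
   nothing. *)
have split3 G : unit_bounded G -> \int[mu2]_(z in I01sq) (G z)%:E =
    \int[mu2]_(z in pre_on phi (E 1%R)) (G z)%:E +
    \int[mu2]_(z in pre_on phi (E 0%R)) (G z)%:E.
  move=> bG.
  have <- : pre_on phi (E 1%R `|` E 0%R `|` not01 U) = I01sq.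
    rewrite /E -setIUr -preimage_setU [X in _ @^-1` X]setUC setUIDK.
    by rewrite /pre_on extend2_I01sq// setIid.
  rewrite integral_pre_onU//; last 2 first.
  - by rewrite pre_onU; exact: measurableU.
  - by apply/seteqP; split => // z [[[_ Uz]|[_ Uz]] [_]]; apply; [right|left].
  rewrite integral_pre_onU//; last first.
    apply/seteqP; split => // z [[_ /= Uz1] [_ /= Uz0]].
    by move: Uz1; rewrite Uz0 => /esym/eqP; rewrite oner_eq0.
  rewrite [X in _ + X](_ : _ = 0) ?adde0//.
  apply/eqP; rewrite -abse_eq0 eq_le abse_ge0 andbT -[leRHS]U0 -Z0.
  by apply: unit_bounded_integral_le => //; exact: pre_on_sub.
have bVu := unit_bounded_norm (unit_bounded_sub gV gu).
have bWu := unit_bounded_norm (unit_bounded_sub gW gu).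
rewrite /norm1 (split3 _ bVu) (split3 _ bWu).
have fin G c : unit_bounded G ->
    \int[mu2]_(z in pre_on phi (E c)) (G z)%:E \is a fin_num.
  by move=> bG; apply: fin_num_integral_pre_on => //; have [] := pre _ (mE c) (@EI _).
have bint G c : unit_bounded G ->
    mu2.-integrable (pre_on phi (E c)) (EFin \o (G : lebT2 R -> R)).
  move=> bG; apply: unit_bounded_integrable => //; last exact: pre_on_sub.
  by have [] := pre _ (mE c) (@EI _).
(* Where u = 1, the integrand is 1 - V = (1 - W) - (V - W); where u = 0, it is V = W + (V - W). *)
have on1 : \int[mu2]_(z in pre_on phi (E 1%R)) `|(V \- u)%R z|%:E =
    \int[mu2]_(z in pre_on phi (E 1%R)) `|(W \- u)%R z|%:E -
    \int[mu2]_(z in pre_on phi (E 1%R)) ((V \- W)%R z)%:E.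
  rewrite -integralB_EFin//; [|exact: bint bWu|exact: bint bVW].
  apply: eq_integral => z /set_mem Ez.
  have /andP[_ V1] := gV.2 z Ez.1; have /andP[_ W1] := gW.2 z Ez.1.
  rewrite /= (uE _ _ Ez) -EFinB !ler0_norm ?subr_le0//.
  by congr (_%:E); ring.
have on0 : \int[mu2]_(z in pre_on phi (E 0%R)) `|(V \- u)%R z|%:E =
    \int[mu2]_(z in pre_on phi (E 0%R)) `|(W \- u)%R z|%:E +
    \int[mu2]_(z in pre_on phi (E 0%R)) ((V \- W)%R z)%:E.
  rewrite -integralD_EFin//; [|exact: bint bWu|exact: bint bVW].
  apply: eq_integral => z /set_mem Ez.
  have /andP[V0 _] := gV.2 z Ez.1; have /andP[W0 _] := gW.2 z Ez.1.
  rewrite /= (uE _ _ Ez) -EFinD !ger0_norm ?subr_ge0//.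
  by congr (_%:E); ring.
rewrite on1 on0.
move: P1 P0.
rewrite -(fineK (fin _ 1%R bVW)) -(fineK (fin _ 0%R bVW)).
rewrite -(fineK (fin _ 1%R bWu)) -(fineK (fin _ 0%R bWu)).
move: (fine _) (fine _) (fine _) (fine _) => x1 x0 y1 y0.
rewrite !abse_EFin -EFinB -!EFinD !lee_fin !ler_norml => /andP[h1 h2] /andP[h3 h4].
by clear -h1 h2 h3 h4; split; lra.
Qed.

(** Markov's inequality: a value in [a, 1 - a] is at distance at least [a] from both 0 and 1.
    Relabelling by [psi] keeps the measure of the set where [W] takes such values. *)
Lemma not01_norm1 (U W : R * R -> R) (phi psi : R -> R) (a : R) :
  Phi0 phi -> Phi0 psi -> graphon U -> graphon W -> mu2 (not01 U) = 0 ->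
  (0 < a)%R ->
  a%:E * mu2 (I01sq `&` W @^-1` `[a, (1 - a)%R]%classic) <=
  norm1 (pullback W psi \- pullback U phi)%R.
Proof.
move=> phiP psiP gU gW U0 a0.
have gu := graphon_pullback phiP gU; have gw := graphon_pullback psiP gW.
have [mD _] := unit_bounded_sub gw gu.
have mS := graphon_preimage gW (measurable_itv `[a, (1 - a)%R]).
have [mpS <-] := measurable_extend2 psiP mS (@subIsetl _ _ _).
have [mpZ Z0] := measurable_extend2 phiP (measurable_not01 gU) (@subDsetl _ _ _).
have mI := measurable_I01sq.
have := le_integral_abse mu2 mI (g := EFin \o (pullback W psi \- pullback U phi)%R)
  _ a0.
move=> /(_ (iffRL (measurable_EFinP _ _) mD)).
apply: le_trans; rewrite lee_pmul2l// ?lte_fin//.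
set K := (X in _ <= lebesgue_measure2 X).
have mK : measurable K.
  have mG : measurable_fun (I01sq : set (lebT2 R))
      (abse \o (EFin \o (pullback W psi \- pullback U phi)%R)).
    by apply: measurableT_comp => //; exact/measurable_EFinP.
  exact: (emeasurable_fun_c_infty mI mG).
(* Adjoining the null set where the pullback of [U] is not 0/1-valued makes the inclusion hold at
   every point. *)
rewrite -[leRHS](measureU0 mK mpZ); last by rewrite Z0.
apply: le_measure; rewrite ?inE//; first exact: measurableU.
move=> [x y] [/= Iz]; rewrite in_itv/= => /andP[aW Wa].
have {Iz} [Ix Iy] : I01sq (x, y).
  by rewrite -(extend2_I01sq psiP).
have [Zxy|nZ] := pselect ((extend2 phi @^-1` not01 U) (x, y)); first by right.
left; split => //=; rewrite lee_fin.
move: aW Wa; rewrite /extend2 /pullback/= !extend_I01// => aW Wa.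
have : [set 0%R; 1%R] (U (phi x, phi y)).
  apply: contrapT => nU; apply: nZ; split; last by rewrite /= /extend2/= !extend_I01.
  by split; exact/extend_in.
case=> ->; rewrite ?subr0.
  by rewrite ger0_norm// (le_trans (ltW a0)).
by rewrite ler0_norm ?opprB ?subr_le0; lra.
Qed.

Lemma not01_eq0 (W : R * R -> R) : graphon W ->
  (forall a : R, (0 < a)%R ->
    mu2 (I01sq `&` W @^-1` `[a, (1 - a)%R]%classic) = 0) ->
  mu2 (not01 W) = 0.
Proof.
move=> gW W0; apply/negligibleP; first exact: measurable_not01.
(* The bands [1/(n+1), 1 - 1/(n+1)] exhaust the open interval (0, 1). *)
apply: (@negligibleS _ _ _ mu2
  (\bigcup_n (I01sq `&` W @^-1` `[n.+1%:R^-1%R, (1 - n.+1%:R^-1)%R]%classic))); last first.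
  apply: negligible_bigcup => n; apply/negligibleP.
    exact: graphon_preimage (measurable_itv _).
  by apply: W0; rewrite invr_gt0.
move=> z [Iz nz]; have /andP[Wz0 Wz1] := gW.2 z Iz.
have m0 : (0 < Num.min (W z) (1 - W z))%R.
  rewrite lt_min subr_gt0 !lt_neqAle Wz0 Wz1 !andbT; apply/andP; split.
    by apply/eqP => h; apply: nz; left.
  by apply/eqP => h; apply: nz; right.
have [n _ /(_ n (leqnn n))/=] := near_infty_natSinv_lt (PosNum m0).
rewrite lt_min => /andP[n1 n2]; exists n => //; split => //=.
by rewrite in_itv/= (ltW n1)/= lerBrDr -lerBrDl ltW.
Qed.

Lemma norm1_ge0 (W : R * R -> R) : 0 <= norm1 W.
Proof. by apply: integral_ge0 => z _; rewrite lee_fin. Qed.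

Lemma norm1_subrr (W : R * R -> R) : norm1 (W \- W)%R = 0.
Proof. by rewrite /norm1 integral0_eq// => z _; rewrite /= subrr normr0. Qed.

End unit_square.

(** * L1 convergence to 0/1-valued limits, and failure of the Cauchy property otherwise *)

Theorem theorem17 (R : realType) (W : R * R -> R) (W_ : nat -> R * R -> R)
    (hW : graphon W) (hW_ : forall n, graphon (W_ n))
    (hcut : delta_cut (W_ n) W @[n --> \oo] --> 0) :
  (lebesgue_measure2 (I01sq `&` W @^-1` [set 0%R; 1%R]) = 1 ->
     delta1 (W_ n) W @[n --> \oo] --> 0) /\
  (lebesgue_measure2 (I01sq `&` W @^-1` [set 0%R; 1%R]) < 1 ->
     (forall n, \forall z \ae lebesgue_measure2,
        I01sq z -> W_ n z = 0%R \/ W_ n z = 1%R) ->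
     ~ exists k : nat -> nat,
         {homo k : i j / (i < j)%N} /\ cauchy_for (@delta1 R) (W_ \o k)).
Proof.
have cut_near (d : R) : (0 < d)%R ->
    \forall n \near \oo, exists2 phi, Phi0 phi &
      cut_norm (W_ n \- pullback W phi)%R < d%:E.
  move=> d0; have d0' : 0 < d%:E by rewrite lte_fin.
  have [N _ hN] := hcut _ (open_ereal_lt' d0'); exists N => // n /hN.
  by move=> /ereal_inf_lt[_ [phi phiP <-] ?]; exists phi.
split => [W1|W1 W01 [k [kinc kcauchy]]].
  have W0 : lebesgue_measure2 (not01 W) = 0.
    have := not01_measure hW; rewrite W1 => h.
    by rewrite -[LHS](@addeK _ 1)// [X in X - _]addeC h subee.
  apply: cvge0 => [n|e e0].
    by apply: le_ereal_inf_tmp => _ [phi _ <-]; exact: norm1_ge0.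
  have [d d0 Pd] := norm1_cut_close hW W0 e0.
  apply: filterS (cut_near d d0) => n [phi phiP cd].
  have gp := graphon_pullback phiP hW.
  (* The second graphon is [pullback W phi] itself, so its own distance term vanishes and only [e]
     remains. *)
  have [+ _] := Pd phi _ _ phiP (hW_ n) gp cd.
  rewrite norm1_subrr add0e; apply: le_trans.
  by apply: ereal_inf_lbound; exists phi.
suff W0 : lebesgue_measure2 (not01 W) = 0.
  by have := not01_measure hW; rewrite W0 adde0 => h; rewrite h ltxx in W1.
apply: not01_eq0 => // a a0.
apply/eqP; rewrite -measure_le0; apply/lee_addgt0Pr => e e0; rewrite add0e.
(* One half is spent on the Cauchy estimate, the other on the cut-norm comparison; the factor [a]
   cancels the one from Markov's inequality. *)
have c0 : (0 < a * e / 2)%R by rewrite divr_gt0// mulr_gt0.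
have [N cauchyN] := kcauchy _ c0.
pose U := W_ (k N).
have U0 : lebesgue_measure2 (not01 U) = 0.
  apply/negligibleP; first exact: measurable_not01 (hW_ (k N)).
  have [A [mA A0 nA]] := W01 (k N).
  by exists A; split => // z [Iz nz]; apply: nA => /= /(_ Iz).
(* [U] is fixed before [d], and [d] before [M], so the index [n] can be taken beyond both [N] and
   [M]. *)
have [d d0 Pd] := norm1_cut_close (hW_ (k N)) U0 c0.
have [M _ PM] := cut_near d d0.
have kge i : (i <= k i)%N.
  by elim: i => // i IHi; apply: leq_ltn_trans IHi _; exact: kinc.
pose n := maxn N M.
have [psi psiP cpsi] := PM (k n) (leq_trans (leq_maxr N M) (kge n)).
have /ereal_inf_lt[_ [phi phiP <-] nphi] :=
  cauchyN n N (leq_maxl N M) (leqnn N).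
have gp := graphon_pullback psiP hW.
(* Here [phi] comes from the L1 distance to [U] and [psi] from the cut distance to [W]; nothing
   relates them, hence the need for uniformity in [phi]. *)
have [_ h] := Pd phi _ _ phiP (hW_ (k n)) gp cpsi.
rewrite -(@lee_pmul2l _ a%:E)//.
apply: le_trans (not01_norm1 phiP psiP (hW_ (k N)) hW U0 a0) _.
apply: le_trans h _; rewrite -EFinM.
by rewrite [leRHS](congr1 EFin (splitr _)) EFinD; apply: leeD => //; exact: ltW nphi.
Qed.
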